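(* Let $\mathbb{K}$ be a field and $G$ a group. Suppose that $\Delta$ is a connected component of the groupoid $\Gamma(G)$ with finitely many vertices. Then $\mathbb{K}\Delta$ is flat as a left $\mathbb{K}_{par}G$-module.
   Context: $\mathbb{K}_{par}G$ is the unital associative $\mathbb{K}$-algebra generated by symbols $[g]$, $g\in G$, subject to $[g][h][h^{-1}]=[gh][h^{-1}]$, $[g^{-1}][g][h]=[g^{-1}][gh]$ and $[1]=1$ for all $g,h\in G$. $\Gamma(G)$ is the groupoid whose objects (vertices) are the subsets of $G$ containing $1$ and whose morphisms are the pairs $(A,g)$ with $A\subseteq G$ and $1,g^{-1}\in A$; $(A,g)$ is an arrow from $A$ to $gA$, and $(gA,g')\circ(A,g)=(A,g'g)$. For a connected component $\Delta$, $\mathcal{V}_\Delta$ is its set of vertices, and $\mathbb{K}\Delta$ is the groupoid algebra (basis: the morphisms of $\Delta$; product is composition when defined and $0$ otherwise). When $\mathcal{V}_\Delta$ is finite there is an algebra homomorphism $\lambda_\Delta:\mathbb{K}_{par}G\to\mathbb{K}\Delta$, $\lambda_\Delta([g])=\sum_{C\in\mathcal{V}_\Delta,\ g^{-1}\in C}(C,g)$, and $\mathbb{K}\Delta$ is viewed as a left $\mathbb{K}_{par}G$-module via $[g]\cdot a=\lambda_\Delta([g])a$. *)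

(* Defs.v *)
From HB Require Import structures.
From mathcomp Require Import all_boot all_algebra finmap.
From mathcomp Require Import boolp classical_sets functions cardinality fsbigop.
From mathcomp Require Import multinomials.monalg.

Set Implicit Arguments.
Unset Strict Implicit.
Unset Printing Implicit Defensive.

Import GRing.Theory.
Local Open Scope classical_set_scope.
Local Open Scope quotient_scope.
Local Open Scope ring_scope.

(* {malg R[X]} is the free left R-module on the choiceType X, with basis the
   elements << x >>; lin_ext F is the R-linear map sending << x >> to F x. *)
HB.lock Definition lin_ext (R : nzRingType) (X : choiceType) (V : lmodType R)
    (F : X -> V) (a : {malg R[X]}) : V :=
  \sum_(x <- msupp a) a@_x *: F x.

Section LinearExtension.
Variables (R : nzRingType) (X : choiceType) (V : lmodType R).

Local Notation lin_ext := (@lin_ext R X V).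

Lemma lin_extEw F (d : {fset X}) a :
  (msupp a `<=` d)%fset -> lin_ext F a = \sum_(x <- d) a@_x *: F x.
Proof.
move=> le; rewrite lin_ext.unlock.
rewrite [LHS](big_fset_incl _ le) => //= x xd /mcoeff_outdom ->.
by rewrite scale0r.
Qed.

Lemma lin_extU F c x : lin_ext F << c *g x >> = c *: F x.
Proof. by rewrite (lin_extEw _ msuppU_le) big_seq_fset1 mcoeffUU. Qed.

Lemma lin_ext1 F x : lin_ext F << x >> = F x.
Proof. by rewrite lin_extU scale1r. Qed.

Lemma lin_extB F : zmod_morphism (lin_ext F).
Proof.
move=> a b; pose d := (msupp a `|` msupp b)%fset.
rewrite (@lin_extEw F d (a - b)) ?msuppB_le // (@lin_extEw F d a) ?fsubsetUl //.
rewrite (@lin_extEw F d b) ?fsubsetUr // -sumrB; apply: eq_bigr => x _.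
by rewrite mcoeffB scalerBl.
Qed.

HB.instance Definition _ F :=
  GRing.isZmodMorphism.Build {malg R[X]} V (lin_ext F) (lin_extB F).

Lemma lin_extZ F : scalable (lin_ext F).
Proof.
move=> c a; rewrite (lin_extEw _ (msuppZ_le c a)).
rewrite (lin_extEw _ (fsubset_refl (msupp a))) scaler_sumr.
by apply: eq_bigr => x _; rewrite mcoeffZ scalerA.
Qed.

HB.instance Definition _ F :=
  GRing.isScalable.Build R {malg R[X]} V *:%R (lin_ext F) (lin_extZ F).

Lemma lin_ext_sub F F' a :
  lin_ext (fun x => F x - F' x) a = lin_ext F a - lin_ext F' a.
Proof.
by rewrite lin_ext.unlock -sumrB; apply: eq_bigr => x _; rewrite scalerBr.
Qed.

Lemma malgUE c (x : X) : << c *g x >> = c *: << x >> :> {malg R[X]}.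
Proof. by apply/malgP=> k; rewrite mcoeffZ !mcoeffU mulrnAr mulr1. Qed.

Lemma malg_linW (f g : {linear {malg R[X]} -> V}) :
  (forall x, f << x >> = g << x >>) -> f =1 g.
Proof.
move=> fg a; rewrite [a]monalgE !linear_sum; apply: eq_bigr => x _.
by rewrite malgUE (linearZZ f) (linearZZ g) fg.
Qed.

End LinearExtension.

(* {malg int[X]} is the free abelian group on X; add_ext F is the group morphism
   sending << x >> to F x. *)
HB.lock Definition add_ext (X : choiceType) (V : zmodType) (F : X -> V)
    (a : {malg int[X]}) : V :=
  \sum_(x <- msupp a) F x *~ a@_x.

Section AdditiveExtension.
Variables (X : choiceType) (V : zmodType).

Local Notation add_ext := (@add_ext X V).

Lemma add_extEw F (d : {fset X}) a :
  (msupp a `<=` d)%fset -> add_ext F a = \sum_(x <- d) F x *~ a@_x.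
Proof.
move=> le; rewrite add_ext.unlock.
rewrite [LHS](big_fset_incl _ le) => //= x xd /mcoeff_outdom ->.
by rewrite mulr0z.
Qed.

Lemma add_ext1 F x : add_ext F << x >> = F x.
Proof. by rewrite (add_extEw _ msuppU_le) big_seq_fset1 mcoeffUU. Qed.

Lemma add_extB F : zmod_morphism (add_ext F).
Proof.
move=> a b; pose d := (msupp a `|` msupp b)%fset.
rewrite (@add_extEw F d (a - b)) ?msuppB_le // (@add_extEw F d a) ?fsubsetUl //.
rewrite (@add_extEw F d b) ?fsubsetUr // -sumrB; apply: eq_bigr => x _.
by rewrite mcoeffB mulrzBr.
Qed.

HB.instance Definition _ F :=
  GRing.isZmodMorphism.Build {malg int[X]} V (add_ext F) (add_extB F).

End AdditiveExtension.

Section Subgroup.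
Variables (V : zmodType) (S : set V).

Definition subgroup (H : set V) : Prop :=
  H 0 /\ forall x y, H x -> H y -> H (x - y).

Definition subgroup_gen : {pred V} :=
  fun x => `[< forall H, subgroup H -> S `<=` H -> H x >].

Lemma subgroup_gen_zmod_closed : zmod_closed subgroup_gen.
Proof.
split=> [|x y]; rewrite !unfold_in; first by apply/asboolP => H [].
move=> /asboolP Hx /asboolP Hy; apply/asboolP => H sH SH.
by apply: sH.2; [apply: Hx|apply: Hy].
Qed.

HB.instance Definition _ :=
  GRing.isZmodClosed.Build V subgroup_gen subgroup_gen_zmod_closed.

Lemma mem_subgroup_gen x : S x -> x \in subgroup_gen.
Proof. by move=> Sx; rewrite unfold_in; apply/asboolP => H _; apply. Qed.

Lemma subgroup_genW (H : set V) x :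
  subgroup H -> S `<=` H -> x \in subgroup_gen -> H x.
Proof. by move=> sH SH; rewrite unfold_in => /asboolP; apply. Qed.

End Subgroup.

(* Right modules over R are left modules over the opposite ring R^c. *)
Section Tensor.
Variable R : pzRingType.

Definition tensor_rel (N : lmodType R^c) (M : lmodType R) :
    set {malg int[(N * M)%type]} :=
  [set t | [\/ exists n n' m,
                 t = << (n + n', m) >> - << (n, m) >> - << (n', m) >>,
               exists n m m',
                 t = << (n, m + m') >> - << (n, m) >> - << (n, m') >>
             | exists n (r : R) m,
                 t = << ((r : R^c) *: n, m) >> - << (n, r *: m) >>]].

Definition tensor (N : lmodType R^c) (M : lmodType R) : Type :=
  Quotient.quot (subgroup_gen (@tensor_rel N M)).
HB.instance Definition _ N M := GRing.Zmodule.on (tensor N M).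
HB.instance Definition _ N M := Quotient.on (tensor N M).

Definition pure_tensor (N : lmodType R^c) (M : lmodType R) (n : N) (m : M) :
  tensor N M := \pi_(tensor N M) << (n, m) >>.

Lemma tensor_piB (N : lmodType R^c) (M : lmodType R) :
  {morph \pi_(tensor N M) : a b / a - b}.
Proof. by move=> a b; rewrite !piE. Qed.

Lemma tensor_piP (N : lmodType R^c) (M : lmodType R) a b :
  \pi_(tensor N M) a = \pi_(tensor N M) b
    <-> a - b \in subgroup_gen (@tensor_rel N M).
Proof. by rewrite Quotient.idealrBE; split=> [->|/eqP]. Qed.

Lemma pure_tensorDl (N : lmodType R^c) (M : lmodType R) (n n' : N) (m : M) :
  pure_tensor (n + n') m = pure_tensor n m + pure_tensor n' m.
Proof.
apply/eqP; rewrite -subr_eq0 opprD addrA -!tensor_piB.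
have -> : 0 = \pi_(tensor N M) 0 by rewrite piE.
apply/eqP/tensor_piP; rewrite subr0; apply: mem_subgroup_gen.
by apply: Or31; exists n, n', m.
Qed.

Lemma pure_tensorDr (N : lmodType R^c) (M : lmodType R) (n : N) (m m' : M) :
  pure_tensor n (m + m') = pure_tensor n m + pure_tensor n m'.
Proof.
apply/eqP; rewrite -subr_eq0 opprD addrA -!tensor_piB.
have -> : 0 = \pi_(tensor N M) 0 by rewrite piE.
apply/eqP/tensor_piP; rewrite subr0; apply: mem_subgroup_gen.
by apply: Or32; exists n, m, m'.
Qed.

Lemma pure_tensorZ (N : lmodType R^c) (M : lmodType R) (n : N) (r : R) (m : M) :
  pure_tensor ((r : R^c) *: n) m = pure_tensor n (r *: m).
Proof.
by apply/tensor_piP/mem_subgroup_gen/Or33; exists n, r, m.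
Qed.

(* f (x) id_M *)
Definition tensor_map (N N' : lmodType R^c) (M : lmodType R)
    (f : {linear N -> N'}) (t : tensor N M) : tensor N' M :=
  add_ext (fun p : N * M => pure_tensor (f p.1) p.2) (repr t).

Lemma tensor_map_pi (N N' : lmodType R^c) (M : lmodType R)
    (f : {linear N -> N'}) (a : {malg int[(N * M)%type]}) :
  tensor_map f (\pi_(tensor N M) a)
    = add_ext (fun p : N * M => pure_tensor (f p.1) p.2) a.
Proof.
apply/eqP; rewrite -subr_eq0 /tensor_map -add_extB; apply/eqP.
have /tensor_piP : \pi_(tensor N M) (repr (\pi_(tensor N M) a))
  = \pi_(tensor N M) a by rewrite reprK.
apply: subgroup_genW (_ : subgroup (fun b => add_ext _ b = 0)) _.
  split=> [|x y x0 y0]; first exact: raddf0.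
  by rewrite add_extB x0 y0 subr0.
move=> t [[n [n' [m ->]]]|[n [m [m' ->]]]|[n [r [m ->]]]];
  rewrite !add_extB !add_ext1 /=.
- by rewrite raddfD pure_tensorDl addrAC addrK subrr.
- by rewrite pure_tensorDr addrAC addrK subrr.
- by rewrite linearZ pure_tensorZ subrr.
Qed.

Lemma tensor_map_pure (N N' : lmodType R^c) (M : lmodType R)
    (f : {linear N -> N'}) (n : N) (m : M) :
  tensor_map f (pure_tensor n m) = pure_tensor (f n) m.
Proof. by rewrite tensor_map_pi add_ext1. Qed.

Lemma tensor_mapB (N N' : lmodType R^c) (M : lmodType R)
    (f : {linear N -> N'}) : zmod_morphism (@tensor_map N N' M f).
Proof.
elim/quotW=> a; elim/quotW=> b.
by rewrite -tensor_piB !tensor_map_pi add_extB.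
Qed.

HB.instance Definition _ (N N' : lmodType R^c) (M : lmodType R)
    (f : {linear N -> N'}) :=
  GRing.isZmodMorphism.Build (tensor N M) (tensor N' M) (tensor_map f)
    (tensor_mapB f).

Definition flat (M : lmodType R) : Prop :=
  forall (N N' : lmodType R^c) (f : {linear N -> N'}),
    injective f -> injective (@tensor_map N N' M f).

End Tensor.

Section TwoSidedIdeal.
Variables (R : pzRingType) (S : set R).

Definition two_sided_ideal (I : set R) : Prop :=
  [/\ subgroup I, forall a x, I x -> I (a * x) & forall a x, I x -> I (x * a)].

Definition ideal_gen : {pred R} :=
  fun x => `[< forall I, two_sided_ideal I -> S `<=` I -> I x >].

Lemma ideal_genW (I : set R) x :
  two_sided_ideal I -> S `<=` I -> x \in ideal_gen -> I x.
Proof. by move=> iI SI; rewrite unfold_in => /asboolP; apply. Qed.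

Lemma mem_ideal_gen x : S x -> x \in ideal_gen.
Proof. by move=> Sx; rewrite unfold_in; apply/asboolP => I _; apply. Qed.

Lemma ideal_gen_zmod_closed : zmod_closed ideal_gen.
Proof.
split=> [|x y]; first by rewrite unfold_in; apply/asboolP => I [[]].
move=> Ix Iy; rewrite unfold_in; apply/asboolP => I iI SI.
by case: (iI) => -[_ iB] _ _; apply: iB; apply: ideal_genW.
Qed.

HB.instance Definition _ :=
  GRing.isZmodClosed.Build R ideal_gen ideal_gen_zmod_closed.

Lemma ideal_genMl a x : x \in ideal_gen -> a * x \in ideal_gen.
Proof.
move=> Ix; rewrite unfold_in; apply/asboolP => I iI SI.
by case: (iI) => _ iM _; apply: iM; apply: ideal_genW.
Qed.

Lemma ideal_genMr a x : x \in ideal_gen -> x * a \in ideal_gen.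
Proof.
move=> Ix; rewrite unfold_in; apply/asboolP => I iI SI.
by case: (iI) => _ _ iM; apply: iM; apply: ideal_genW.
Qed.

Lemma ideal_genMB a b a' b' : a' - a \in ideal_gen -> b' - b \in ideal_gen ->
  a' * b' - a * b \in ideal_gen.
Proof.
move=> Ia Ib; have -> : a' * b' - a * b = (a' - a) * b' + a * (b' - b).
  by rewrite mulrBl mulrBr addrA addrNK.
by apply: rpredD; [exact: ideal_genMr|exact: ideal_genMl].
Qed.

End TwoSidedIdeal.

(* The free unital associative K-algebra on X is the monoid algebra of the free
   monoid on X. Its product is locked to keep unification from unfolding it. *)
HB.lock Definition free_mul (K : fieldType) (X : choiceType)
    (a b : {malg K[{fmonom X}]}) : {malg K[{fmonom X}]} := a * b.

Section FreeAlgebra.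
Variables (K : fieldType) (X : choiceType).

Let malg_scaleAr (c : K) (a b : {malg K[{fmonom X}]}) :
  c *: (a * b) = a * (c *: b).
Proof.
have cC : c%:MP * a = a * c%:MP.
  rewrite !malgM_def fgmulUg fgmulgU; apply: eq_bigr => k _.
  by rewrite mul1m mulm1 mulrC.
by rewrite -(mul_malgC c b) mulrA -cC -mulrA mul_malgC.
Qed.

Definition free_alg : Type := {malg K[{fmonom X}]}.
HB.instance Definition _ := GRing.Lmodule.on free_alg.

Implicit Types a b : free_alg.

Let mul : free_alg -> free_alg -> free_alg := @free_mul K X.
Let one : free_alg := (1 : {malg K[{fmonom X}]}).

Let mulE (a b : {malg K[{fmonom X}]}) : mul a b = a * b.
Proof. by rewrite /mul free_mul.unlock. Qed.

Let mulA : associative mul.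
Proof. by move=> a b c; rewrite !mulE; exact: mulrA. Qed.
Let mul1 : left_id one mul.
Proof. by move=> a; rewrite !mulE; exact: mul1r. Qed.
Let mulr1 : right_id one mul.
Proof. by move=> a; rewrite !mulE; exact: mulr1. Qed.
Let mulDl : left_distributive mul +%R.
Proof. by move=> a b c; rewrite !mulE; exact: mulrDl. Qed.
Let mulDr : right_distributive mul +%R.
Proof. by move=> a b c; rewrite !mulE; exact: mulrDr. Qed.
Let one_neq0 : one != 0.
Proof. exact: (@oner_neq0 {malg K[{fmonom X}]}). Qed.

HB.instance Definition _ := GRing.Zmodule_isNzRing.Build free_alg
  mulA mul1 mulr1 mulDl mulDr one_neq0.

Let scaleAl (c : K) a b : c *: mul a b = mul (c *: a) b.
Proof. by rewrite !mulE; exact: scalerAl. Qed.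

HB.instance Definition _ := GRing.Lmodule_isLalgebra.Build K free_alg scaleAl.

Let scaleAr (c : K) a b : c *: mul a b = mul a (c *: b).
Proof. by rewrite !mulE; exact: malg_scaleAr. Qed.

HB.instance Definition _ := GRing.Lalgebra_isAlgebra.Build K free_alg scaleAr.

End FreeAlgebra.

HB.lock Definition free_gen (K : fieldType) (X : choiceType) (x : X) :
  free_alg K X := (<< fmu x >> : {malg K[{fmonom X}]}).

Section FreeEvaluation.
Variables (K : fieldType) (X : choiceType) (A : algType K) (phi : X -> A).

(* Evaluation of a noncommutative polynomial at phi : X -> A. *)
Definition free_eval : free_alg K X -> A :=
  lin_ext (fun m : {fmonom X} => \prod_(x <- (m : seq X)) phi x).

HB.instance Definition _ :=
  GRing.Linear.copy (free_eval)
    (lin_ext (fun m : {fmonom X} => \prod_(x <- (m : seq X)) phi x)).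

Lemma free_eval_monoid_morphism : monoid_morphism (free_eval).
Proof.
split=> [|a b]; first by rewrite /free_eval lin_ext1 fm1 big_nil.
rewrite -[a * b]/(free_mul a b) free_mul.unlock malgME [LHS]linear_sum /= /free_eval.
rewrite (lin_extEw _ (fsubset_refl (msupp a))).
rewrite (lin_extEw _ (fsubset_refl (msupp b))) mulr_suml; apply: eq_bigr => k _.
rewrite [LHS]linear_sum mulr_sumr; apply: eq_bigr => l _.
by rewrite [LHS]lin_extU fmM big_cat /= -scalerAl -scalerAr scalerA.
Qed.

HB.instance Definition _ :=
  GRing.isMonoidMorphism.Build (free_alg K X) A (free_eval)
    free_eval_monoid_morphism.

Lemma free_eval_gen x : free_eval (free_gen K x) = phi x.
Proof. by rewrite /free_eval free_gen.unlock lin_ext1 fmuE big_seq1. Qed.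

End FreeEvaluation.

Section PartialGroupAlgebra.
Variables (K : fieldType) (G : groupType).

Let gen (g : G) : free_alg K G := free_gen K g.

Definition par_rel : set (free_alg K G) :=
  [set r | [\/ exists g h,
                 r = gen g * gen h * gen h^-1 - gen (g * h)%g * gen h^-1,
               exists g h,
                 r = gen g^-1 * gen g * gen h - gen g^-1 * gen (g * h)%g
             | r = gen 1%g - 1]].

Definition par_alg : Type := Quotient.quot (ideal_gen par_rel).
HB.instance Definition _ := GRing.Zmodule.on par_alg.
HB.instance Definition _ := Quotient.on par_alg.

Local Notation pi := (\pi_par_alg).

Lemma par_piP (a b : free_alg K G) :
  (pi a = pi b) <-> (a - b \in ideal_gen par_rel).
Proof. by rewrite Quotient.idealrBE; split=> [->|/eqP]. Qed.

Lemma par_piB : {morph pi : a b / a - b}.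
Proof. by move=> a b; rewrite !piE. Qed.

Lemma par_piD : {morph pi : a b / a + b}.
Proof. by move=> a b; rewrite !piE. Qed.

Definition par_mul : par_alg -> par_alg -> par_alg := lift_op2 par_alg *%R.
Definition par_scale (c : K) : par_alg -> par_alg := lift_op1 par_alg ( *:%R c).

Lemma par_piM : {morph pi : a b / a * b >-> par_mul a b}.
Proof.
move=> a b; unlock par_mul; apply/esym/par_piP.
have Ia : repr (pi a) - a \in ideal_gen par_rel by apply/par_piP; rewrite reprK.
have Ib : repr (pi b) - b \in ideal_gen par_rel by apply/par_piP; rewrite reprK.
exact: ideal_genMB.
Qed.

Lemma par_piZ c : {morph pi : a / c *: a >-> par_scale c a}.
Proof.
move=> a; unlock par_scale; apply/esym/par_piP.
rewrite -scalerBr -mulr_algl; apply: ideal_genMl.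
by apply/par_piP; rewrite reprK.
Qed.

Lemma par_mulA : associative par_mul.
Proof.
elim/quotW=> a; elim/quotW=> b; elim/quotW=> c.
by rewrite -(par_piM b c) -(par_piM a b) -(par_piM a) -(par_piM (a * b)) mulrA.
Qed.

Lemma par_mul1 : left_id (pi 1) par_mul.
Proof. by elim/quotW=> a; rewrite -par_piM mul1r. Qed.

Lemma par_mulr1 : right_id (pi 1) par_mul.
Proof. by elim/quotW=> a; rewrite -par_piM mulr1. Qed.

Lemma par_mulDl : left_distributive par_mul +%R.
Proof.
elim/quotW=> a; elim/quotW=> b; elim/quotW=> c.
by rewrite -par_piD -(par_piM (a + b)) -(par_piM a) -(par_piM b) -par_piD mulrDl.
Qed.

Lemma par_mulDr : right_distributive par_mul +%R.
Proof.
elim/quotW=> a; elim/quotW=> b; elim/quotW=> c.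
by rewrite -par_piD -(par_piM a (b + c)) -(par_piM a) -(par_piM a) -par_piD mulrDr.
Qed.

(* The ideal of relations is contained in the kernel of any evaluation that
   satisfies them. *)
Definition par_compat (A : algType K) (phi : G -> A) : Prop :=
  [/\ forall g h, phi g * phi h * phi h^-1%g = phi (g * h)%g * phi h^-1%g,
      forall g h, phi g^-1%g * phi g * phi h = phi g^-1%g * phi (g * h)%g
    & phi 1%g = 1].

Lemma par_rel_eval0 (A : algType K) (phi : G -> A) (r : free_alg K G) :
  par_compat phi -> r \in ideal_gen par_rel -> free_eval phi r = 0.
Proof.
move=> [c1 c2 c3].
apply: ideal_genW (_ : two_sided_ideal (fun a => free_eval phi a = 0)) _.
  split=> [|b x x0|b x x0]; last 2 first.
  - by rewrite rmorphM /= x0 mulr0.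
  - by rewrite rmorphM /= x0 mul0r.
  by split=> [|x y x0 y0]; rewrite (raddf0, raddfB) //= x0 y0 subr0.
have evM a b : free_eval phi (a * b) = free_eval phi a * free_eval phi b.
  exact: rmorphM.
have evB a b : free_eval phi (a - b) = free_eval phi a - free_eval phi b.
  exact: raddfB.
move=> _ [[g [h ->]]|[g [h ->]]|->].
- by rewrite evB !evM !free_eval_gen c1 subrr.
- by rewrite evB !evM !free_eval_gen c2 subrr.
- by rewrite evB free_eval_gen rmorph1 c3 subrr.
Qed.

Lemma par_one_neq0 : pi 1 != 0 :> par_alg.
Proof.
have -> : 0 = pi 0 :> par_alg by rewrite piE.
apply/eqP => /par_piP; rewrite subr0.
move=> /(@par_rel_eval0 K^o (fun=> 1)); rewrite rmorph1.
have h : par_compat (fun=> 1 : K^o) by split=> *; rewrite ?mulr1.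
by move=> /(_ h)/eqP; rewrite oner_eq0.
Qed.

HB.instance Definition _ := GRing.Zmodule_isNzRing.Build par_alg
  par_mulA par_mul1 par_mulr1 par_mulDl par_mulDr par_one_neq0.

Lemma par_scaleA c d (x : par_alg) :
  par_scale c (par_scale d x) = par_scale (c * d) x.
Proof.
elim/quotW: x => a.
by rewrite -(par_piZ d) -(par_piZ c) -(par_piZ (c * d)) scalerA.
Qed.

Lemma par_scale1 : left_id 1 par_scale.
Proof. by elim/quotW=> a; rewrite -par_piZ scale1r. Qed.

Lemma par_scaleDr : right_distributive par_scale +%R.
Proof.
move=> c; elim/quotW=> a; elim/quotW=> b.
by rewrite -par_piD -(par_piZ c (a + b)) -(par_piZ c a) -(par_piZ c b)
           -par_piD scalerDr.
Qed.

Lemma par_scaleDl (x : par_alg) : {morph par_scale^~ x : c d / c + d}.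
Proof.
move=> c d /=; elim/quotW: x => a.
by rewrite -(par_piZ (c + d)) -(par_piZ c) -(par_piZ d) -par_piD scalerDl.
Qed.

HB.instance Definition _ := GRing.Zmodule_isLmodule.Build K par_alg
  par_scaleA par_scale1 par_scaleDr par_scaleDl.

Lemma par_scaleAl c (x y : par_alg) : c *: (x * y) = c *: x * y.
Proof.
elim/quotW: x => a; elim/quotW: y => b.
rewrite -[c *: pi a](par_piZ c) -[pi a * _](par_piM a b) -[_ * pi b]par_piM.
by rewrite -[LHS]par_piZ scalerAl.
Qed.

HB.instance Definition _ := GRing.Lmodule_isLalgebra.Build K par_alg par_scaleAl.

Lemma par_scaleAr c (x y : par_alg) : c *: (x * y) = x * (c *: y).
Proof.
elim/quotW: x => a; elim/quotW: y => b.
rewrite -[c *: pi b](par_piZ c) -[pi a * pi b](par_piM a b) -[pi a * _]par_piM.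
by rewrite -[LHS]par_piZ scalerAr.
Qed.

HB.instance Definition _ := GRing.Lalgebra_isAlgebra.Build K par_alg par_scaleAr.

(* The generator [g]. *)
Definition par_gen (g : G) : par_alg := pi (gen g).

Lemma par_genP : par_compat par_gen.
Proof.
have piM a b : pi a * pi b = pi (a * b) :> par_alg by exact/esym/par_piM.
split=> [g h|g h|]; rewrite /par_gen.
- rewrite (piM (gen g)) (piM (gen g * gen h)) (piM (gen (g * h)%g)).
  by apply/par_piP/mem_ideal_gen/Or31; exists g, h.
- rewrite (piM (gen g^-1)) (piM (gen g^-1 * gen g)) (piM (gen g^-1)).
  by apply/par_piP/mem_ideal_gen/Or32; exists g, h.
- by apply/par_piP/mem_ideal_gen/Or33.
Qed.

(* The universal property: the algebra morphism [g] |-> phi g. *)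
Section Lift.
Variables (A : algType K) (phi : G -> A).

Definition par_lift (x : par_alg) : A := free_eval phi (repr x).

Hypothesis phiP : par_compat phi.

Lemma par_lift_pi a : par_lift (pi a) = free_eval phi a.
Proof.
apply/eqP; rewrite -subr_eq0 -raddfB /=; apply/eqP.
by apply: par_rel_eval0 => //; apply/par_piP; rewrite reprK.
Qed.

Lemma par_lift_gen g : par_lift (par_gen g) = phi g.
Proof. by rewrite par_lift_pi free_eval_gen. Qed.

Lemma par_liftB : zmod_morphism par_lift.
Proof.
elim/quotW=> a; elim/quotW=> b; rewrite -par_piB !par_lift_pi.
exact: raddfB.
Qed.

Lemma par_liftM : monoid_morphism par_lift.
Proof.
split; first by rewrite par_lift_pi rmorph1.
elim/quotW=> a; elim/quotW=> b.
by rewrite -[_ * _](par_piM a b) !par_lift_pi rmorphM.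
Qed.

Lemma par_liftZ : scalable par_lift.
Proof.
move=> c; elim/quotW=> a; rewrite -[_ *: _](par_piZ c a) !par_lift_pi.
exact: linearZZ.
Qed.

End Lift.
End PartialGroupAlgebra.

Section Groupoid.
Variable G : groupType.

(* gA *)
Definition translate (g : G) (A : set G) : set G := [set (g * a)%g | a in A].

(* The arrows of Gamma(G), as a predicate on pairs (A, g). *)
Definition arrow (x : set G * G) : Prop := x.1 1%g /\ x.1 x.2^-1%g.

Definition source (x : set G * G) : set G := x.1.
Definition target (x : set G * G) : set G := translate x.2 x.1.

(* y o x, meaningful when source y = target x *)
Definition compose (y x : set G * G) : set G * G := (x.1, (y.2 * x.2)%g).

Definition connected (A B : set G) : Prop :=
  exists x, [/\ arrow x, source x = A & target x = B].

Record component := Component {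
  vertices : set (set G);
  componentP : exists2 A : set G, A 1%g & vertices = [set B | connected A B]
}.

Lemma translateE g A a : translate g A a = A (g^-1 * a)%g.
Proof.
apply/propext; split=> [[b Ab <-]|Aa]; first by rewrite mulKg.
by exists (g^-1 * a)%g; rewrite ?mulVKg.
Qed.

Lemma translate1 A : translate 1%g A = A.
Proof. by apply/funext => a; rewrite translateE invg1 mul1g. Qed.

Lemma translateM g h A : translate g (translate h A) = translate (g * h)%g A.
Proof. by apply/funext => a; rewrite !translateE invgM mulgA. Qed.

Lemma target_vertex x : arrow x -> target x 1%g.
Proof. by case=> _ xV; rewrite /target translateE mulg1. Qed.

Lemma arrow_id A : A 1%g -> arrow (A, 1%g).
Proof. by move=> A1; split; rewrite ?invg1. Qed.

Lemma target_compose y x :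
  source y = target x -> target (compose y x) = target y.
Proof. by rewrite /source /target => ->; rewrite translateM. Qed.

Lemma arrow_compose y x :
  source y = target x -> arrow x -> arrow y -> arrow (compose y x).
Proof.
rewrite /source /target /arrow => -> [x1 _] [_]; rewrite translateE => yV.
by split=> //=; rewrite invgM.
Qed.

Lemma component_vertex (D : component) A : vertices D A -> A 1%g.
Proof.
case: D => /= _ [B B1 ->] [x [xa _ <-]]; exact: target_vertex.
Qed.

Lemma component_target (D : component) x :
  arrow x -> vertices D (source x) -> vertices D (target x).
Proof.
case: D => /= _ [A A1 ->] xa [y [ya yA yx]].
exists (compose x y); split=> //; first by apply: arrow_compose.
by rewrite target_compose.
Qed.

Lemma component_ex (D : component) : exists A, vertices D A.
Proof.
case: D => /= _ [A A1 ->]; exists A, (A, 1%g); split=> //.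
  exact: arrow_id.
exact: translate1.
Qed.

End Groupoid.

(* The arrows of a component *)
Section ComponentArrow.
Variables (G : groupType) (D : component G).

Definition comp_arrow_pred : pred (set G * G) :=
  fun x => `[< [/\ arrow x, vertices D (source x) & vertices D (target x)] >].

Definition comp_arrow : Type := {x : set G * G | comp_arrow_pred x}.
HB.instance Definition _ := SubChoice.on comp_arrow.

Lemma comp_arrowP (x : comp_arrow) :
  [/\ arrow (val x), vertices D (source (val x)) & vertices D (target (val x))].
Proof. exact/asboolP/(valP x). Qed.

Fact comp_arrow_compose (y x : comp_arrow) :
  source (val y) = target (val x) -> comp_arrow_pred (compose (val y) (val x)).
Proof.
case: (comp_arrowP x) (comp_arrowP y) => xa xs xt [ya ys yt] yx.
apply/asboolP; split=> //; first exact: arrow_compose.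
by rewrite target_compose.
Qed.

End ComponentArrow.

(* The product y * x of two arrows in the groupoid algebra. *)
Definition arrow_mul (K : fieldType) (G : groupType) (D : component G)
    (y x : comp_arrow D) : {malg K[comp_arrow D]} :=
  if pselect (source (val y) = target (val x)) is left yx
  then << exist _ (compose (val y) (val x)) (comp_arrow_compose yx) >> else 0.

HB.lock Definition groupoid_mul (K : fieldType) (G : groupType)
    (D : component G) (b a : {malg K[comp_arrow D]}) : {malg K[comp_arrow D]} :=
  lin_ext (fun y => lin_ext (fun x => arrow_mul K y x) a) b.

Lemma bilinear_assoc (K : fieldType) (V : lmodType K) (X : Type) (e : X -> V)
    (mul : V -> V -> V) :
  (forall P : V -> Prop,
    P 0 -> (forall k x a, P a -> P (k *: e x + a)) -> forall a, P a) ->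
  left_distributive mul +%R -> right_distributive mul +%R ->
  (forall k a b, mul (k *: a) b = k *: mul a b) ->
  (forall k a b, mul a (k *: b) = k *: mul a b) ->
  (forall x y z, mul (e x) (mul (e y) (e z)) = mul (mul (e x) (e y)) (e z)) ->
  associative mul.
Proof.
move=> ind mDl mDr mZl mZr mA.
have m0l a : mul 0 a = 0 by have := mZl 0 0 a; rewrite !scale0r.
have m0r a : mul a 0 = 0 by have := mZr 0 a 0; rewrite !scale0r.
move=> a b c; elim/ind: a => [|k x a IH]; first by rewrite !m0l.
rewrite !mDl !mZl {}IH; congr (_ *: _ + _).
elim/ind: b => [|l y b IHb]; first by rewrite m0l !m0r m0l.
rewrite mDr !mDl mDr {}IHb !mZl !mZr mZl; congr (_ *: _ + _).
elim/ind: c => [|m z c IHc]; first by rewrite !m0r.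
by rewrite !mDr !mZr IHc mA.
Qed.

Lemma linear_id (K : fieldType) (V : lmodType K) (X : Type) (e : X -> V)
    (f : V -> V) :
  (forall P : V -> Prop,
    P 0 -> (forall k x a, P a -> P (k *: e x + a)) -> forall a, P a) ->
  {morph f : a b / a + b} -> scalable f -> (forall x, f (e x) = e x) -> f =1 id.
Proof.
move=> ind fD fZ fe; elim/ind => [|k x a IH].
  by have := fZ 0 0; rewrite !scale0r.
by rewrite fD fZ fe IH.
Qed.

(* The groupoid algebra. It is unital because the set of vertices is finite. *)
Definition groupoid_alg (K : fieldType) (G : groupType) (D : component G)
  of finite_set (vertices D) : Type := {malg K[comp_arrow D]}.

HB.instance Definition _ (K : fieldType) (G : groupType) (D : component G)
    (finD : finite_set (vertices D)) :=
  GRing.Lmodule.on (groupoid_alg K finD).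

(* The arrow (A, g) as an element of the algebra, 0 if it is not an arrow of the
   component. *)
HB.lock Definition arrow_elt (K : fieldType) (G : groupType) (D : component G)
    (finD : finite_set (vertices D)) (p : set G * G) : groupoid_alg K finD :=
  if insub p is Some x then (<< x >> : {malg K[comp_arrow D]}) else 0.

Section GroupoidAlgebra.
Variables (K : fieldType) (G : groupType) (D : component G).
Variable finD : finite_set (vertices D).

Local Notation groupoid_alg := (groupoid_alg K finD).
Local Notation arrow_elt := (arrow_elt K finD).

Let mul : groupoid_alg -> groupoid_alg -> groupoid_alg := @groupoid_mul K G D.
Let one : groupoid_alg := \sum_(A \in vertices D) arrow_elt (A, 1%g).

Implicit Types (a b c : groupoid_alg) (x y z : comp_arrow D) (p q : set G * G).

Lemma arrow_eltE x : arrow_elt (val x) = (<< x >> : {malg K[comp_arrow D]}).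
Proof. by rewrite arrow_elt.unlock valK. Qed.

Lemma groupoid_alg_ind (P : groupoid_alg -> Prop) :
  P 0 -> (forall k x a, P a -> P (k *: arrow_elt (val x) + a)) -> forall a, P a.
Proof.
move=> P0 PD a; rewrite -[a]/(a : {malg K[comp_arrow D]}).
rewrite (monalgE (a : {malg K[comp_arrow D]})).
elim: (enum_fset _) => [|x s IHs]; first by rewrite big_nil.
by rewrite big_cons malgUE; have := PD (mcoeff x a) x _ IHs; rewrite arrow_eltE.
Qed.

Let gmulDl : left_distributive mul +%R.
Proof. by move=> a b c; rewrite /mul groupoid_mul.unlock [LHS]raddfD. Qed.

Let gmul0l a : mul 0 a = 0.
Proof. by rewrite /mul groupoid_mul.unlock [LHS]raddf0. Qed.

Let gmulZl k a b : mul (k *: a) b = k *: mul a b.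
Proof. by rewrite /mul groupoid_mul.unlock [LHS]linearZZ. Qed.

Let mulEl x a : mul (arrow_elt (val x)) a = lin_ext (fun y => arrow_mul K x y) a.
Proof. by rewrite arrow_eltE /mul groupoid_mul.unlock lin_ext1. Qed.

Let gmulDr : right_distributive mul +%R.
Proof.
move=> a b c; elim/groupoid_alg_ind: a => [|k x a IH].
  by rewrite !gmul0l addr0.
by rewrite !gmulDl !gmulZl IH !mulEl raddfD scalerDr addrACA.
Qed.

Let gmul0r a : mul a 0 = 0.
Proof. by apply: (@addrI _ (mul a 0)); rewrite -gmulDr !addr0. Qed.

Let gmulZr k a b : mul a (k *: b) = k *: mul a b.
Proof.
elim/groupoid_alg_ind: a => [|k' x a IH]; first by rewrite !gmul0l scaler0.
by rewrite !gmulDl !gmulZl IH !mulEl linearZZ scalerDr !scalerA mulrC.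
Qed.

Let mulE x y : mul (arrow_elt (val x)) (arrow_elt (val y)) =
  if `[< source (val x) = target (val y) >]
  then arrow_elt (compose (val x) (val y)) else 0.
Proof.
rewrite mulEl arrow_eltE lin_ext1 /arrow_mul.
case: pselect => xy; last by rewrite asboolF.
by rewrite asboolT //; exact/esym/(arrow_eltE (exist _ _ _)).
Qed.

Let mul_elt p q : comp_arrow_pred D p -> comp_arrow_pred D q ->
  mul (arrow_elt p) (arrow_elt q) =
  if `[< source p = target q >] then arrow_elt (compose p q) else 0.
Proof. by move=> pP qP; exact: (mulE (exist _ p pP) (exist _ q qP)). Qed.

Lemma comp_arrow_predP A g :
  vertices D A -> A g^-1%g -> comp_arrow_pred D (A, g).
Proof.
move=> DA Ag; have A1 := component_vertex DA.
by apply/asboolP; split=> //; apply: component_target.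
Qed.

Let gmulA : associative mul.
Proof.
apply: (bilinear_assoc groupoid_alg_ind gmulDl gmulDr gmulZl gmulZr) => x y z.
rewrite !mulE; case: asboolP => [yz|yz]; case: asboolP => [xy|xy].
- rewrite mul_elt; [|exact: valP|exact: comp_arrow_compose].
  rewrite mul_elt; [|exact: comp_arrow_compose|exact: valP].
  rewrite target_compose // !asboolT //.
  by rewrite /compose mulgA.
- rewrite gmul0l mul_elt; [|exact: valP|exact: comp_arrow_compose].
  by rewrite target_compose // asboolF.
- rewrite gmul0r mul_elt; [|exact: comp_arrow_compose|exact: valP].
  by rewrite asboolF.
- by rewrite gmul0r gmul0l.
Qed.

Let mul_suml (I : choiceType) (s : seq I) (F : I -> groupoid_alg) a :
  mul (\sum_(i <- s) F i) a = \sum_(i <- s) mul (F i) a.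
Proof. by elim/big_ind2: _ => [|_ b _ c <- <-|//]; rewrite ?gmul0l ?gmulDl. Qed.

Let mul_sumr (I : choiceType) (s : seq I) (F : I -> groupoid_alg) a :
  mul a (\sum_(i <- s) F i) = \sum_(i <- s) mul a (F i).
Proof. by elim/big_ind2: _ => [|_ b _ c <- <-|//]; rewrite ?gmul0r ?gmulDr. Qed.

Let id_pred A : vertices D A -> comp_arrow_pred D (A, 1%g).
Proof.
by move=> DA; apply: comp_arrow_predP; rewrite ?invg1 //; apply: component_vertex DA.
Qed.

Let gmul1 : left_id one mul.
Proof.
apply: (linear_id groupoid_alg_ind) => [a b|k a|x].
- exact: gmulDr.
- exact: gmulZr.
rewrite /one fsbig_finite //= mul_suml.
have [xa xs xt] := comp_arrowP x.
rewrite (bigD1_seq (target (val x))) ?fset_uniq ?in_fset_set ?inE //=.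
rewrite mul_elt ?id_pred ?asboolT //; last exact: valP.
rewrite /compose mul1g big_seq_cond big1 ?addr0; first by case: (val x).
move=> A /andP[]; rewrite in_fset_set // inE => DA /eqP nA.
by rewrite mul_elt ?id_pred ?asboolF //; exact: valP.
Qed.

Let gmulr1 : right_id one mul.
Proof.
apply: (linear_id (f := mul^~ one) groupoid_alg_ind) => [a b|k a|x] /=.
- exact: gmulDl.
- exact: gmulZl.
rewrite /one fsbig_finite //= mul_sumr.
have [xa xs xt] := comp_arrowP x.
rewrite (bigD1_seq (source (val x))) ?fset_uniq ?in_fset_set ?inE //=.
have tE A : target (A, 1%g : G) = A by exact: translate1.
rewrite mul_elt ?id_pred ?asboolT ?tE //; last exact: valP.
rewrite /compose mulg1 big_seq_cond big1 ?addr0; first by case: (val x).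
move=> A /andP[]; rewrite in_fset_set // inE => DA /eqP nA.
rewrite mul_elt ?id_pred ?asboolF //; last exact: valP.
by rewrite tE => /esym.
Qed.

Let one_neq0 : one != 0.
Proof.
have [A DA] := component_ex D; pose x : comp_arrow D := exist _ (A, 1%g) (id_pred DA).
apply/eqP => one0; have := gmul1 (arrow_elt (val x)).
rewrite one0 gmul0l arrow_eltE.
move=> /(congr1 (fun a : {malg K[comp_arrow D]} => a@_x)).
by rewrite mcoeff0 mcoeffUU => /esym/eqP; rewrite oner_eq0.
Qed.

HB.instance Definition _ := GRing.Zmodule_isNzRing.Build groupoid_alg
  gmulA gmul1 gmulr1 gmulDl gmulDr one_neq0.

Let scaleAl k a b : k *: mul a b = mul (k *: a) b.
Proof. by rewrite gmulZl. Qed.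

HB.instance Definition _ := GRing.Lmodule_isLalgebra.Build K groupoid_alg scaleAl.

Let scaleAr k a b : k *: mul a b = mul a (k *: b).
Proof. by rewrite gmulZr. Qed.

HB.instance Definition _ := GRing.Lalgebra_isAlgebra.Build K groupoid_alg scaleAr.

Lemma groupoid_oneE : 1 = \sum_(A \in vertices D) arrow_elt (A, 1%g).
Proof. by []. Qed.

Lemma arrow_eltM p q : comp_arrow_pred D p -> comp_arrow_pred D q ->
  arrow_elt p * arrow_elt q =
  if `[< source p = target q >] then arrow_elt (compose p q) else 0.
Proof. exact: mul_elt. Qed.

Definition lambda_gen (g : G) : groupoid_alg :=
  \sum_(C \in vertices D `&` [set C | C g^-1%g]) arrow_elt (C, g).

Lemma lambda_gen_elt g p : comp_arrow_pred D p ->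
  lambda_gen g * arrow_elt p =
  if `[< target p g^-1%g >] then arrow_elt (p.1, (g * p.2)%g) else 0.
Proof.
move=> pP; have [pa ps pt] := comp_arrowP (exist _ p pP : comp_arrow D).
have fin : finite_set (vertices D `&` [set C | C g^-1%g]).
  exact: finite_setIl.
rewrite /lambda_gen fsbig_finite //= mulr_suml.
have -> : \sum_(C <- fset_set (vertices D `&` [set C | C g^-1%g]))
    arrow_elt (C, g) * arrow_elt p =
  \sum_(C <- fset_set (vertices D `&` [set C | C g^-1%g]))
    if `[< C = target p >] then arrow_elt (p.1, (g * p.2)%g) else 0.
  rewrite big_seq [RHS]big_seq; apply: eq_bigr => C.
  rewrite in_fset_set // inE => -[DC Cg].
  by rewrite arrow_eltM //; exact: comp_arrow_predP.
case: asboolP => [tg|tg]; last first.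
  rewrite big_seq big1 // => C; rewrite in_fset_set // inE => -[DC Cg].
  by rewrite asboolF // => Ct; apply: tg; rewrite -Ct.
rewrite (bigD1_seq (target p)) ?fset_uniq ?in_fset_set ?inE //=.
rewrite asboolT // big1 ?addr0 // => C /eqP nC; rewrite asboolF //.
Qed.

Lemma comp_arrow_pred_mul g p : comp_arrow_pred D p -> target p g^-1%g ->
  comp_arrow_pred D (p.1, (g * p.2)%g).
Proof.
move=> pP; have [pa ps pt] := comp_arrowP (exist _ p pP : comp_arrow D).
by rewrite /target translateE => ?; apply: comp_arrow_predP; rewrite ?invgM.
Qed.

Lemma groupoid_alg_eqP a b :
  (forall p, comp_arrow_pred D p -> a * arrow_elt p = b * arrow_elt p) -> a = b.
Proof.
move=> ab; rewrite -[a]mulr1 -[b]mulr1 groupoid_oneE fsbig_finite //= !mulr_sumr.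
rewrite big_seq [RHS]big_seq; apply: eq_bigr => A.
by rewrite in_fset_set // inE => DA; apply: ab; apply: id_pred.
Qed.

Let target_mul g p (u : G) :
  target (p.1, (g * p.2)%g) u = target p (g^-1 * u)%g.
Proof. by rewrite /target -translateM translateE. Qed.

Lemma lambda_compat : par_compat lambda_gen.
Proof.
split=> [g h|g h|]; apply: groupoid_alg_eqP => p pP;
  have [[_ p1] ps pt] := comp_arrowP (exist _ p pP : comp_arrow D);
  have pt1 := component_vertex pt; rewrite /= in p1 ps pt pt1.
- rewrite -!mulrA (lambda_gen_elt _ pP) invgK.
  case: asboolP => hp; last by rewrite !mulr0.
  have qP : comp_arrow_pred D (p.1, (h^-1 * p.2)%g).
    by apply: comp_arrow_pred_mul => //; rewrite invgK.
  rewrite !(lambda_gen_elt _ qP) !target_mul /= invgK mulgV (asboolT pt1).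
  rewrite mulVKg -surjective_pairing (lambda_gen_elt _ pP).
  by rewrite invgM mulVKg mulgA mulgK.
- rewrite -!mulrA (lambda_gen_elt h pP) (lambda_gen_elt (g * h)%g pP).
  case: (asboolP (target p h^-1%g)) => hp; last first.
    rewrite !mulr0; case: asboolP => ghp; last by rewrite mulr0.
    rewrite (lambda_gen_elt _ (comp_arrow_pred_mul pP ghp)) target_mul invgK.
    by rewrite invgM mulgVK asboolF.
  have qP := comp_arrow_pred_mul pP hp.
  rewrite (lambda_gen_elt g qP) target_mul invgM /= mulgA.
  by [].
- rewrite mul1r lambda_gen_elt // invg1 asboolT // mul1g.
  by rewrite -surjective_pairing.
Qed.

(* The algebra morphism lambda_Delta *)
Definition lambda : par_alg K G -> groupoid_alg := par_lift lambda_gen.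

HB.instance Definition _ := GRing.isZmodMorphism.Build (par_alg K G)
  groupoid_alg lambda (par_liftB lambda_compat).
HB.instance Definition _ := GRing.isMonoidMorphism.Build (par_alg K G)
  groupoid_alg lambda (par_liftM lambda_compat).
HB.instance Definition _ := GRing.isScalable.Build K (par_alg K G)
  groupoid_alg *:%R lambda (par_liftZ lambda_compat).

Lemma lambdaE g : lambda (par_gen K g) =
  \sum_(C \in vertices D `&` [set C | C g^-1%g]) arrow_elt (C, g).
Proof. exact: par_lift_gen lambda_compat g. Qed.

End GroupoidAlgebra.

(* The groupoid algebra as a left module over the partial group algebra. *)
Section GroupoidModule.
Variables (K : fieldType) (G : groupType) (D : component G).
Variable finD : finite_set (vertices D).

Definition groupoid_module : Type := groupoid_alg K finD.
HB.instance Definition _ := GRing.Zmodule.on groupoid_module.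

Definition par_act (r : par_alg K G) (a : groupoid_module) : groupoid_module :=
  lambda finD r * (a : groupoid_alg K finD).

Let par_actA r s a : par_act r (par_act s a) = par_act (r * s) a.
Proof. by rewrite /par_act rmorphM mulrA. Qed.

Let par_act1 : left_id 1 par_act.
Proof. by move=> a; rewrite /par_act rmorph1 mul1r. Qed.

Let par_actDr : right_distributive par_act +%R.
Proof. by move=> r a b; exact: mulrDr. Qed.

Let par_actDl a : {morph par_act^~ a : r s / r + s}.
Proof. by move=> r s; rewrite /par_act raddfD mulrDl. Qed.

HB.instance Definition _ := GRing.Zmodule_isLmodule.Build (par_alg K G)
  groupoid_module par_actA par_act1 par_actDr par_actDl.

Lemma par_actE (r : par_alg K G) (a : groupoid_module) :
  r *: a = lambda finD r * (a : groupoid_alg K finD) :> groupoid_alg K finD.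
Proof. by []. Qed.

End GroupoidModule.

(* Main.v *)
From HB Require Import structures.
Require Import Defs.
From mathcomp Require Import all_boot all_algebra finmap.
From mathcomp Require Import boolp classical_sets cardinality.
From mathcomp Require Import multinomials.monalg.

Set Implicit Arguments.
Unset Strict Implicit.
Unset Printing Implicit Defensive.

Import GRing.Theory.
Local Open Scope classical_set_scope.
Local Open Scope ring_scope.

(** Write R for the partial group algebra. The morphism lambda from R to KDelta is
onto, and KDelta is flat because the kernel of lambda has local right units:
the module is cyclic, generated by 1, and such a module is flat as soon as every
x in the annihilator of the generator m0 is killed on the right by some u that
fixes m0 ([cyclic_flat]). Indeed every element of a tensor product of N with
such a module is n (x) m0, and it vanishes exactly when n u = 0 for some u
fixing m0 ([pure_tensor_eq0]), a condition that injective maps reflect.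

The elements u come from the commuting idempotents e_h = [h][h^-1], which can be
thought of as the indicators of the sets { C | h in C } on the space of vertices.
For a finite list L of elements of G, the product [cylinder L A] of the e_h with
h in A and of the 1 - e_h with h not in A, h running over L, is the indicator of
the vertices that agree with A on L. The K-linear map [cyl_section L] from KDelta
to R sends the arrow (A, g) to [g] cylinder L A. It has two properties:
- once L separates the finitely many vertices of Delta, lambda maps cylinder L A
  to the identity (A, 1), so that cyl_section L is a section of lambda
  ([cyl_sectionK]); in particular lambda is onto;
- for each x in R, x * cyl_section L 1 = cyl_section L (lambda x) as soon as L is
  large enough in terms of x ([cyl_section_mul]): for h^-1 in A, the element
  [g][h] cylinder L A is [gh] cylinder L A when (gh)^-1 is in A and 0 otherwise,
  which is how lambda [g] multiplies the arrow (A, h).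
If lambda x = 0, then u = cyl_section L 1 satisfies x u = 0 and lambda u = 1. *)

(** * Flatness of cyclic modules with local units *)

Section CyclicFlat.
Variables (R : pzRingType) (M : lmodType R) (m0 : M).
Hypothesis gen_m0 : forall m, exists r : R, r *: m0 = m.
Hypothesis local_unit :
  forall x : R, x *: m0 = 0 -> exists2 u : R, u *: m0 = m0 & x * u = 0.

Lemma pure_tensor0l (N : lmodType R^c) (m : M) : pure_tensor (0 : N) m = 0.
Proof. by apply: (@addrI _ (pure_tensor 0 m)); rewrite -pure_tensorDl !addr0. Qed.

Lemma tensor_cyclic (N : lmodType R^c) (t : tensor N M) :
  exists n, t = pure_tensor n m0.
Proof.
pose S := [set a : {malg int[(N * M)%type]} |
  exists n, \pi_(tensor N M)%qT a = pure_tensor n m0].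
have S0 : S 0 by exists 0; rewrite pure_tensor0l piE.
have SB a b : S a -> S b -> S (a - b).
  move=> [n an] [n' bn]; exists (n - n'); apply/eqP.
  by rewrite tensor_piB an bn subr_eq -pure_tensorDl subrK.
have SN a : S a -> S (- a) by move=> Sa; rewrite -sub0r; exact: SB.
have SD a b : S a -> S b -> S (a + b).
  by move=> Sa Sb; rewrite -[b]opprK; apply: SB => //; exact: SN.
elim/quotW: t => a; suff: S a by [].
rewrite [a]monalgE; elim: (enum_fset _) => [|[n m] s IHs].
  by rewrite big_nil.
rewrite big_cons; apply: (SD) => //.
have -> : << a@_(n, m) *g (n, m) >> =
    << (n, m) >> *~ a@_(n, m) :> {malg int[(N * M)%type]}.
  apply/malgP => k; rewrite mcoeffU raddfMz /= mcoeffU.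
  by case: (_ == k); rewrite ?mul0rz // mulr1n intz.
have Sn k : S (<< (n, m) >> *+ k).
  elim: k => // k IHk; rewrite mulrS; apply: (SD) => //.
  by have [r <-] := gen_m0 m; exists ((r : R^c) *: n); rewrite pure_tensorZ.
by case: (a@_(n, m)) => k; rewrite ?NegzE ?mulrNz; [|apply: SN]; exact: Sn.
Qed.

Definition killed (N : lmodType R^c) : set N :=
  [set n | exists2 u : R, u *: m0 = m0 & (u : R^c) *: n = 0].

Lemma scaleAc (N : lmodType R^c) (r s : R) (n : N) :
  (r : R^c) *: ((s : R^c) *: n) = (s * r : R^c) *: n.
Proof. by rewrite scalerA. Qed.

(** Given v u = 0 and w u' = 0, the product (1 - u') u annihilates m0; a local
unit z for it gives v (u z) = 0 and w (u z) = w (1 - u') u z = 0. *)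
Lemma killed_subgroup (N : lmodType R^c) : subgroup (@killed N).
Proof.
split=> [|v w [u um uv] [u' um' uw]]; first by exists 1; rewrite ?scale1r ?scaler0.
have [|z zm xz] := local_unit (x := (1 - u') * u).
  by rewrite -scalerA um scalerBl um' scale1r subrr.
exists (u * z); first by rewrite -scalerA zm.
rewrite scalerBr -(scaleAc z u v) uv scaler0 sub0r.
suff -> : (u * z : R^c) *: w = ((1 - u') * u * z : R^c) *: w.
  by rewrite xz scale0r oppr0.
rewrite -mulrA -(scaleAc (u * z) (1 - u')).
by rewrite [X in _ = _ *: X]scalerBl uw subr0 [X in _ = _ *: X]scale1r.
Qed.

Lemma killed_ann (N : lmodType R^c) (x : R) (n : N) :
  x *: m0 = 0 -> @killed N ((x : R^c) *: n).
Proof.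
by move=> /local_unit[u um xu]; exists u; rewrite // scaleAc xu scale0r.
Qed.

(** With a set-theoretic section s of r |-> r m0, the assignment
n (x) m |-> n s(m) respects the defining relations of the tensor product up to
killed elements, so it sends every relation into [killed]; it sends n (x) m0 to
n s(m0), which differs from n by a killed element. *)
Lemma pure_tensor_eq0 (N : lmodType R^c) (n : N) :
  pure_tensor n m0 = 0 <-> @killed N n.
Proof.
split=> [|[u um un]]; last by rewrite -um -pure_tensorZ un pure_tensor0l.
have [s sP] := choice gen_m0.
pose F (p : N * M) : N := (s p.2 : R^c) *: p.1.
have -> : 0 = \pi_(tensor N M)%qT 0 by rewrite piE.
have [killed0 killedB] := killed_subgroup N.
move=> /tensor_piP; rewrite subr0 => rel_n.
have : [set a | killed (add_ext F a)] << (n, m0) >>.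
  apply: subgroup_genW rel_n => [|a].
    split=> [|a b]; first by rewrite /= raddf0.
    by rewrite /= raddfB; exact: killedB.
  move=> [[v [v' [m ->]]]|[v [m [m' ->]]]|[v [r [m ->]]]];
    rewrite /mkset !raddfB /= !add_ext1 /F /=.
  - by rewrite scalerDr addrAC addrK subrr.
  - rewrite -!scalerBl; apply: killed_ann.
    by rewrite !scalerBl !sP addrAC addrK subrr.
  - rewrite scaleAc -scalerBl; apply: killed_ann.
    by rewrite scalerBl -scalerA !sP subrr.
rewrite /mkset add_ext1 => ksn.
have s1 : (s m0 - 1) *: m0 = 0 by rewrite scalerBl sP scale1r subrr.
have := killedB _ _ ksn (killed_ann n s1).
by rewrite scalerBl scale1r opprB addrCA subrr addr0.
Qed.

(** If n (x) m0 is in the kernel, then f (n u) = f n u = 0 for some u fixing m0, so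
n u = 0 by injectivity of f. *)
Lemma cyclic_flat : flat M.
Proof.
move=> N N' f injf; apply: raddf_inj => t.
have [n ->] := tensor_cyclic t; rewrite /= tensor_map_pure.
move=> /pure_tensor_eq0[u um]; rewrite -linearZ /= -(raddf0 f) => /injf un.
by apply/pure_tensor_eq0; exists u.
Qed.

End CyclicFlat.

(** * Cylinder idempotents of the partial group algebra *)

Section Cylinder.
Variables (K : fieldType) (G : groupType).
Implicit Types (g h : G) (A : set G) (L : seq G).
Local Notation gen := (par_gen K).

Definition par_idem h : par_alg K G := gen h * gen h^-1%g.

Lemma par_genK h : gen h * gen h^-1%g * gen h = gen h.
Proof.
have [_ r2 r3] := par_genP K G.
by have := r2 h^-1%g h; rewrite invgK mulVg r3 mulr1.
Qed.

(** Both sides reduce to [gh][h^-1], since [(gh)^-1][gh][h^-1] = [(gh)^-1][g]. *)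
Lemma par_gen_idem g h : gen g * par_idem h = par_idem (g * h)%g * gen g.
Proof.
have [r1 r2 r3] := par_genP K G.
rewrite mulrA r1 -[X in X * _](par_genK (g * h)%g) -!mulrA; congr (_ * _).
by rewrite mulrA -[X in _ = _ * gen X](mulgK h) -r2.
Qed.

Lemma par_idem_idem h : par_idem h * par_idem h = par_idem h.
Proof. by rewrite /par_idem mulrA par_genK. Qed.

Lemma par_idemC g h : par_idem g * par_idem h = par_idem h * par_idem g.
Proof.
by rewrite -mulrA par_gen_idem mulrA par_gen_idem mulVKg -mulrA.
Qed.

Definition cylinder L A : par_alg K G :=
  \prod_(h <- L) if `[< A h >] then par_idem h else 1 - par_idem h.

Lemma par_idem_cylinder h L A : h \in L ->
  par_idem h * cylinder L A = if `[< A h >] then cylinder L A else 0.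
Proof.
rewrite /cylinder; elim: L => // k L IHL; rewrite inE big_cons mulrA.
case: (eqVneq h k) => [<- _|_ /IHL hL].
  case: asboolP => _; rewrite ?par_idem_idem //.
  by rewrite mulrBr mulr1 par_idem_idem subrr mul0r.
suff -> : par_idem h * (if `[< A k >] then par_idem k else 1 - par_idem k) =
  (if `[< A k >] then par_idem k else 1 - par_idem k) * par_idem h.
  by rewrite -mulrA hL; case: `[< A h >]; rewrite ?mulr0.
case: ifP => _; first exact: par_idemC.
by rewrite mulrBl mulrBr mulr1 mul1r par_idemC.
Qed.

(** [g] vanishes on the vertices without g^-1, because [g] = [g] e_(g^-1). *)
Lemma par_gen_cylinder g L A : g^-1%g \in L ->
  gen g * cylinder L A = if `[< A g^-1%g >] then gen g * cylinder L A else 0.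
Proof.
move=> gL; rewrite -[X in X * _ = _](par_genK g) -!mulrA.
have -> : gen g^-1%g * (gen g * cylinder L A) = par_idem g^-1 * cylinder L A.
  by rewrite /par_idem invgK mulrA.
by rewrite par_idem_cylinder //; case: ifP => // _; rewrite mulr0.
Qed.

(** Partial multiplicativity [g][h][h^-1] = [gh][h^-1] becomes multiplicativity
on cylinders on which e_(h^-1) = [h^-1][h] acts as 1. *)
Lemma par_genM_cylinder g h L A : h^-1%g \in L -> A h^-1%g ->
  gen g * (gen h * cylinder L A) = gen (g * h)%g * cylinder L A.
Proof.
move=> hL Ah; have [r1 _ _] := par_genP K G.
have := par_idem_cylinder A hL; rewrite asboolT // => <-.
rewrite /par_idem invgK !mulrA; congr (_ * _).
by rewrite r1.
Qed.

(** The words in the generators span the partial group algebra. *)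
Lemma par_alg_ind (P : par_alg K G -> Prop) :
  P 1 -> (forall g x, P x -> P (gen g * x)) -> (forall x y, P x -> P y -> P (x + y)) ->
  (forall (c : K) x, P x -> P (c *: x)) -> forall x, P x.
Proof.
move=> P1 PM PD PZ; elim/quotW => a.
have P0 : P 0 by rewrite -(scale0r 1); exact: PZ.
pose a' : {malg K[{fmonom G}]} := a; rewrite -[a]/(a' : free_alg K G).
rewrite (monalgE a'); elim: (enum_fset _) => [|m s IHs].
  by rewrite big_nil; have -> : \pi_(par_alg K G)%qT 0 = 0 by rewrite piE.
rewrite big_cons.
have -> := @par_piD K G << a'@_m *g m >> (\sum_(i <- s) << a'@_i *g i >>).
apply: PD => //.
rewrite malgUE; have -> := @par_piZ K G (a'@_m) << m >>; apply: PZ.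
case: m => m; elim: m => [|g m IHm].
  by rewrite -fmoneE.
have -> : (<< FMonom (g :: m) >> : {malg K[{fmonom G}]}) =
   (free_gen K g * (<< FMonom m >> : {malg K[{fmonom G}]}) : free_alg K G).
  rewrite -[RHS]/(free_mul _ _) free_mul.unlock free_gen.unlock malgME.
  rewrite !msuppU oner_eq0 !big_seq_fset1 !mcoeffUU mulr1.
  by congr << _ >>; rewrite -[RHS]/(fmmul _ _) fmuE fmmulE.
by have -> := @par_piM K G (free_gen K g) << FMonom m >>; apply: PM.
Qed.

End Cylinder.

(** * Sections of the morphism to the groupoid algebra *)

Section CylinderSection.
Variables (K : fieldType) (G : groupType) (D : component G).
Variable finD : finite_set (vertices D).
Implicit Types (g h : G) (A : set G) (L : seq G).
Local Notation gen := (par_gen K).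
Local Notation alg := (groupoid_alg K finD).
Local Notation elt := (arrow_elt K finD).

Definition cyl_section L : alg -> par_alg K G :=
  lin_ext (fun x : comp_arrow D => gen (val x).2 * cylinder K L (val x).1).

HB.instance Definition _ L := GRing.Linear.copy (cyl_section L)
  (lin_ext (fun x : comp_arrow D => gen (val x).2 * cylinder K L (val x).1)).

Lemma cyl_section_elt L p : comp_arrow_pred D p ->
  cyl_section L (elt p) = gen p.2 * cylinder K L p.1.
Proof.
move=> pP; have -> := arrow_eltE K finD (exist _ p pP : comp_arrow D).
by rewrite /cyl_section lin_ext1.
Qed.

(** On an arrow (A, h), both sides are [gh] cylinder L A when (gh)^-1 is in A and
0 otherwise, provided that L contains h^-1 and (gh)^-1: hence the bound L0 depends
on the support of a. *)
Lemma cyl_section_gen g (a : alg) : exists L0 : seq G, forall L, {subset L0 <= L} ->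
  gen g * cyl_section L a = cyl_section L (lambda finD (gen g) * a).
Proof.
elim/groupoid_alg_ind: a => [|k x a [L0 IH]].
  by exists [::] => L _; rewrite !(raddf0, mulr0).
have [[_ x1] xs xt] := comp_arrowP x.
have gE : lambda finD (gen g) = lambda_gen K finD g by rewrite lambdaE.
pose h := (val x).2; exists [:: h^-1, (g * h)^-1 & L0]%g => L sL.
have hL : h^-1%g \in L by apply: sL; rewrite !inE eqxx.
have ghL : (g * h)^-1%g \in L by apply: sL; rewrite !inE eqxx orbT.
rewrite mulrDr !raddfD /= mulrDr -IH; last first.
  by move=> y yL; apply: sL; rewrite !inE yL !orbT.
congr (_ + _).
rewrite [cyl_section L (k *: _)]linearZZ -[LHS]scalerAr -[_ * (k *: _)]scalerAr.
rewrite [RHS]linearZZ /=; congr (_ *: _).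
rewrite gE lambda_gen_elt ?(valP x) // cyl_section_elt ?(valP x) //.
rewrite par_genM_cylinder // par_gen_cylinder //.
have -> : target (val x) g^-1%g = (val x).1 (g * h)^-1%g.
  by rewrite /target translateE invgM.
case: asboolP => [Agh|_]; last by rewrite raddf0.
rewrite cyl_section_elt //; apply: comp_arrow_pred_mul (valP x) _.
by rewrite /target translateE -invgM.
Qed.

(** Words act through lambda: by [cyl_section_gen], each letter of x moves from
the left of cyl_section L to the inside once L is large enough. *)
Lemma cyl_section_mul (x : par_alg K G) : exists L0 : seq G, forall L,
  {subset L0 <= L} -> x * cyl_section L 1 = cyl_section L (lambda finD x).
Proof.
elim/par_alg_ind: x => [|g x [L0 IH]|x y [L0 IHx] [L1 IHy]|c x [L0 IH]].
- by exists [::] => L _; rewrite rmorph1 mul1r.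
- have [L1 gL1] := cyl_section_gen g (lambda finD x).
  exists (L0 ++ L1) => L sL; rewrite -mulrA IH ?gL1 ?rmorphM // => h hL;
    by apply: sL; rewrite mem_cat hL ?orbT.
- exists (L0 ++ L1) => L sL; rewrite mulrDl !raddfD IHx ?IHy // => h hL;
    by apply: sL; rewrite mem_cat hL ?orbT.
- exists L0 => L sL; rewrite -scalerAl IH //.
  by rewrite [lambda finD (c *: x)]linearZZ [RHS]linearZZ.
Qed.

Lemma lambda_idem_elt h p : comp_arrow_pred D p ->
  lambda finD (par_idem K h) * elt p = if `[< target p h >] then elt p else 0.
Proof.
move=> pP; rewrite rmorphM /= !lambdaE -!/(lambda_gen K finD _) -mulrA.
rewrite lambda_gen_elt // invgK; case: asboolP => hp; last by rewrite mulr0.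
have [[p1 _] ps pt] := comp_arrowP (exist _ p pP : comp_arrow D).
rewrite lambda_gen_elt; last by apply: comp_arrow_pred_mul => //; rewrite invgK.
rewrite asboolT /= ?mulVKg -?surjective_pairing //.
rewrite /target -translateM translateE invgK mulgV.
exact: component_vertex pt.
Qed.

Lemma lambda_cylinder_elt L A p : comp_arrow_pred D p ->
  lambda finD (cylinder K L A) * elt p =
  if all (fun h => `[< A h >] == `[< target p h >]) L then elt p else 0.
Proof.
move=> pP; rewrite /cylinder; elim: L => [|h L IHL].
  by rewrite big_nil rmorph1 mul1r.
rewrite big_cons rmorphM /= -mulrA IHL.
case: (all _ L); last by rewrite mulr0 andbF.
rewrite andbT; case: `[< A h >]; rewrite ?raddfB /= ?mulrBl ?rmorph1 ?mul1r
  lambda_idem_elt //; case: `[< target p h >]; rewrite ?subrr ?subr0 //=.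
Qed.

Definition separating L := forall A B, vertices D A -> vertices D B ->
  (forall h, h \in L -> A h <-> B h) -> A = B.

(** One element of G suffices to distinguish two given vertices, and there are
finitely many pairs of vertices. *)
Lemma separating_ex : exists L, separating L.
Proof.
have sepP (p : set G * set G) : exists h, (p.1 h <-> p.2 h) -> p.1 = p.2.
  case: p => A B; have [[h hAB]|nAB] := pselect (exists h, ~ (A h <-> B h)).
    by exists h.
  exists 1%g => _ /=; apply/predeqP => h.
  by apply: contrapT => hAB; apply: nAB; exists h.
have [s {}sepP] := choice sepP; pose V := fset_set (vertices D).
exists [seq s (A, B) | A <- enum_fset V, B <- enum_fset V] => A B DA DB AB.
apply: (sepP (A, B)) => /=; apply: AB; apply/allpairsP; exists (A, B) => /=.
by split=> //; rewrite in_fset_set // inE.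
Qed.

Lemma lambda_cylinder L A : separating L -> vertices D A ->
  lambda finD (cylinder K L A) = elt (A, 1%g).
Proof.
move=> sepL DA; apply: groupoid_alg_eqP => p pP.
have [_ _ pt] := comp_arrowP (exist _ p pP : comp_arrow D).
have A1 := component_vertex DA.
rewrite lambda_cylinder_elt // arrow_eltM //; last first.
  by apply: comp_arrow_predP; rewrite ?invg1.
rewrite /compose mul1g -surjective_pairing.
congr (if _ then _ else _); apply/allP/asboolP => [AL|pA h _].
  apply: sepL => // h /AL /eqP AB.
  by split=> [/asboolP|/asboolP]; [rewrite AB|rewrite -AB] => /asboolP.
by rewrite -pA.
Qed.

Lemma cyl_sectionK L : separating L -> cancel (cyl_section L) (lambda finD).
Proof.
move=> sepL a; elim/groupoid_alg_ind: a => [|k x a IH]; first by rewrite !raddf0.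
have [[x1 xV] xs xt] := comp_arrowP x.
have xK : lambda finD (cyl_section L (elt (val x))) = elt (val x).
  rewrite cyl_section_elt ?(valP x) // rmorphM /= lambda_cylinder // lambdaE.
  rewrite -/(lambda_gen K finD _) lambda_gen_elt; last first.
    by apply: comp_arrow_predP; rewrite ?invg1.
  by rewrite /target translate1 asboolT //= mulg1 -surjective_pairing.
by rewrite !raddfD /= IH [cyl_section L _]linearZZ [lambda finD _]linearZZ /= xK.
Qed.

End CylinderSection.

(** * Flatness of the groupoid algebra *)

Theorem theorem6p6 (K : fieldType) (G : groupType) (D : component G)
    (finD : finite_set (vertices D)) :
  flat (groupoid_module K finD : lmodType (par_alg K G)).
Proof.
have [L0 sepL0] := separating_ex finD.
have actE (x : par_alg K G) :
    x *: ((1 : groupoid_alg K finD) : groupoid_module K finD) = lambda finD x.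
  by rewrite [LHS]par_actE mulr1.
apply: (@cyclic_flat _ (groupoid_module K finD) (1 : groupoid_alg K finD)) => [a|x].
  by exists (cyl_section L0 (a : groupoid_alg K finD)); rewrite actE cyl_sectionK.
rewrite actE => x0; have [L1 xL1] := cyl_section_mul finD x.
exists (cyl_section (finD := finD) (L0 ++ L1) 1).
  rewrite actE cyl_sectionK // => A B DA DB AB; apply: sepL0 => // h hL.
  by apply: AB; rewrite mem_cat hL.
by rewrite xL1 ?x0 ?raddf0 // => h hL; rewrite mem_cat hL orbT.
Qed.
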